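(* Let $((\mathbf{u},p),(\boldsymbol{\phi},r),\mathbf{y})\in V\times V\times Q_{ad}$ solve the continuous optimality system and let $((\mathbf{u}_h,p_h),(\boldsymbol{\phi}_h,r_h),\mathbf{y}_h)\in V_h\times V_h\times Q_{ad}^h$ solve the discrete optimality system (both written out in the context). Let $P_h\mathbf{u},\bar P_h\boldsymbol{\phi}\in X_h$ be the projections defined in the context. Then there is a constant $C>0$, independent of the mesh-size, such that $$\|\mathbf{y}-\mathbf{y}_h\|_Q^2+\|\mathbf{u}-\mathbf{u}_h\|_W^2\le C\big(\|E\boldsymbol{\phi}-\Pi_h(E\boldsymbol{\phi})\|_Q^2+\|\mathbf{y}-\Pi_h\mathbf{y}\|_Q^2+\|\boldsymbol{\phi}-\bar P_h\boldsymbol{\phi}\|_h^2+\|\mathbf{u}-P_h\mathbf{u}\|_W^2\big).$$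
   Context: All vector spaces are real. Continuous setting. $X,M,W,Q$ are Hilbert spaces, $V=X\times M$, with $X\subset W\subset X'$ with continuous inclusions ($X'$ the dual of $X$). $E:X\to Q$ is continuous and linear; $Q_{ad}\subset Q$ is nonempty, closed and convex. $\mathbf f,\mathbf u_d\in W$ and $\lambda>0$ are given. $a:X\times X\to\mathbb R$, $b:X\times M\to\mathbb R$ are continuous bilinear forms with $|a(\mathbf v,\mathbf z)|\le C_1\|\mathbf v\|_X\|\mathbf z\|_X$ and $|b(\mathbf z,p)|\le C_2\|\mathbf z\|_X\|p\|_M$; with $Z=\{\mathbf v\in X: b(\mathbf v,w)=0\ \forall w\in M\}$, $a$ is $Z$-elliptic: $\alpha\|\mathbf v\|_X^2\le a(\mathbf v,\mathbf v)$ for all $\mathbf v\in Z$, $\alpha>0$; and $b$ satisfies the inf-sup condition $\inf_{p\in M}\sup_{\mathbf z\in X} b(\mathbf z,p)/(\|\mathbf z\|_X\|p\|_M)\ge\beta>0$. Continuous optimality system for $((\mathbf u,p),(\boldsymbol\phi,r),\mathbf y)\in V\times V\times Q_{ad}$: for all $\mathbf z\in X$, $w\in M$, $\mathbf x\in Q_{ad}$, $a(\mathbf u,\mathbf z)+b(\mathbf z,p)=\langle\mathbf y,E\mathbf z\rangle_Q+\langle\mathbf f,\mathbf z\rangle_W$, $b(\mathbf u,w)=0$, $a(\mathbf z,\boldsymbol\phi)-b(\mathbf z,r)=\langle\mathbf u-\mathbf u_d,\mathbf z\rangle_W$, $b(\boldsymbol\phi,w)=0$, $\langle E\boldsymbol\phi+\lambda\mathbf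 y,\mathbf x-\mathbf y\rangle_Q\ge0$. Discrete setting. $X_h\subset W$ is a finite dimensional subspace, $\|\cdot\|_h$ is a norm on $X+X_h$ with $\|\mathbf v\|_h=\|\mathbf v\|_X$ for $\mathbf v\in X$; $M_h\subset M$ is a finite dimensional subspace with norm $\|\cdot\|_M$; $V_h=X_h\times M_h$; $Q_h\subseteq Q$ is a finite dimensional subspace and $Q_{ad}^h\subset Q_{ad}$ is a nonempty closed convex subset of $Q_h$. $a_h:X_h\times X_h\to\mathbb R$, $b_h:X_h\times M_h\to\mathbb R$ are bilinear with $|a_h(\mathbf v_h,\mathbf z_h)|\le\bar C_1\|\mathbf v_h\|_h\|\mathbf z_h\|_h$, $|b_h(\mathbf z_h,p_h)|\le\bar C_2\|\mathbf z_h\|_h\|p_h\|_M$; with $Z_h=\{\mathbf v_h\in X_h:b_h(\mathbf v_h,w_h)=0\ \forall w_h\in M_h\}$, $\bar\alpha\|\mathbf v_h\|_h^2\le a_h(\mathbf v_h,\mathbf v_h)$ on $Z_h$, $\bar\alpha>0$; and $\inf_{p_h\in M_h}\sup_{\mathbf z_h\in X_h}b_h(\mathbf z_h,p_h)/(\|\mathbf z_h\|_h\|p_h\|_M)\ge\bar C>0$. $E_h:X_h+X\to Q$ is linear with $E_h\mathbf v=E\mathbf v$ for $\mathbf v\in X$. Discrete optimality system for $((\mathbf u_h,p_h),(\boldsymbol\phi_h,r_h),\mathbf y_h)\in V_h\times V_h\times Q_{ad}^h$: for all $\mathbf z_h\in X_h$, $w_h\in M_h$, $\mathbf x_h\in Q_{ad}^h$,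 $a_h(\mathbf u_h,\mathbf z_h)+b_h(\mathbf z_h,p_h)=\langle\mathbf y_h,E_h\mathbf z_h\rangle_Q+\langle\mathbf f,\mathbf z_h\rangle_W$, $b_h(\mathbf u_h,w_h)=0$, $a_h(\mathbf z_h,\boldsymbol\phi_h)-b_h(\mathbf z_h,r_h)=\langle\mathbf u_h-\mathbf u_d,\mathbf z_h\rangle_W$, $b_h(\boldsymbol\phi_h,w_h)=0$, $\langle E_h\boldsymbol\phi_h+\lambda\mathbf y_h,\mathbf x_h-\mathbf y_h\rangle_Q\ge0$. Standing assumptions. (I) $\|\mathbf v\|_W\le C_W\|\mathbf v\|_h$ for all $\mathbf v\in X+X_h$. (II) $\|E_h(\mathbf v-\mathbf v_h)\|_Q\le\|\mathbf v-\mathbf v_h\|_h$ for all $\mathbf v\in X,\mathbf v_h\in X_h$. (III) $\Pi_h:Q\to Q_h$ is the $Q$-orthogonal projection, and $\Pi_h\mathbf x\in Q_{ad}^h$ whenever $\mathbf x\in Q_{ad}$. Projections. $(P_h\mathbf u,R_hp),(\bar P_h\boldsymbol\phi,\bar R_hr)\in X_h\times M_h$ are the unique solutions of: for all $\mathbf z_h\in X_h$, $w_h\in M_h$, $a_h(P_h\mathbf u,\mathbf z_h)+b_h(\mathbf z_h,R_hp)=\langle\mathbf y,E_h\mathbf z_h\rangle_Q+\langle\mathbf f,\mathbf z_h\rangle_W$, $b_h(P_h\mathbf u,w_h)=0$, $a_h(\mathbf z_h,\bar P_h\boldsymbol\phi)-b_h(\mathbf z_h,\bar R_hr)=\langle\mathbf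 u-\mathbf u_d,\mathbf z_h\rangle_W$, $b_h(\bar P_h\boldsymbol\phi,w_h)=0$. ''Independent of the mesh-size'' means: depending only on $\lambda$ and on the constants $C_1,C_2,\alpha,\beta,\bar C_1,\bar C_2,\bar\alpha,\bar C,C_W$. *)

(* Defs.v *)
From HB Require Import structures.
From mathcomp Require Import all_boot all_order all_algebra.
From mathcomp Require Import all_classical all_reals all_analysis.

Set Implicit Arguments.
Unset Strict Implicit.
Unset Printing Implicit Defensive.

Import Order.TTheory GRing.Theory Num.Theory.
Import numFieldNormedType.Exports.

Local Open Scope classical_set_scope.
Local Open Scope ring_scope.

(* A real Hilbert space: a complete normed space whose norm comes from an
   inner product. *)
HB.mixin Record isHilbert (R : realType) T of CompleteNormedModule R T := {
  inner : {dot T for (@idfun R)};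
  inner_norm : forall x : T, inner x x = `|x| ^+ 2
}.

#[short(type="hilbertType")]
HB.structure Definition Hilbert (R : realType) :=
  {T of CompleteNormedModule R T & isHilbert R T}.

Arguments inner {R s}.

Section Subspaces.
Context {R : realType}.

Definition fin_dim_subspace (V : lmodType R) (S : set V) : Prop :=
  exists n (e : 'I_n -> V),
    S = range (fun c : 'rV[R]_n => \sum_(i < n) c ord0 i *: e i).

(* A map on a subspace D of V is represented by a total function on V of which
   only the values on D matter; the next three predicates are relative to D. *)
Definition linear_on (V U : lmodType R) (D : set V) (f : V -> U) : Prop :=
  forall (c : R) (v w : V), D v -> D w -> f (c *: v + w) = c *: f v + f w.

Definition bilinear_on (V U : lmodType R) (D : set V) (F : set U)
    (g : V -> U -> R) : Prop :=
  (forall w, F w -> linear_on (U := R^o) D (g ^~ w)) /\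
  (forall v, D v -> linear_on (U := R^o) F (g v)).

Definition norm_on (V : lmodType R) (D : set V) (N : V -> R) : Prop :=
  [/\ forall v w, D v -> D w -> N (v + w) <= N v + N w,
      forall (c : R) v, D v -> N (c *: v) = `|c| * N v
    & forall v, D v -> N v = 0 -> v = 0].

Definition null_space (V U : Type) (D : set V) (F : set U)
    (b : V -> U -> R) : set V :=
  [set v | D v /\ forall w, F w -> b v w = 0].

(* Taken in the extended reals, over nonzero vectors (in MathComp x / 0 = 0):
   the infimum is +oo if F = 0, the suprema are -oo if D = 0. *)
Definition inf_sup (V U : lmodType R) (D : set V) (NV : V -> R)
    (F : set U) (NU : U -> R) (b : V -> U -> R) : \bar R :=
  ereal_inf [set ereal_sup [set (b z p / (NV z * NU p))%:E | z in D `\ 0]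
            | p in F `\ 0].

Definition orthogonal_projection (Q : hilbertType R) (S : set Q)
    (P : Q -> Q) : Prop :=
  forall x, S (P x) /\ forall q, S q -> inner (x - P x) q = 0.

End Subspaces.

Section Spaces.
Context {R : realType} {X W : hilbertType R}.

(* The continuous inclusions of X in W and of W in the dual X' of X.  The first
   one is the map incl.  The second one sends w to the functional
   x |-> <w, x>_W; its injectivity means that X is dense in W, and its
   continuity is boundedness for the dual norm. *)
Definition gelfand_inclusions (incl : {linear X -> W}) : Prop :=
  [/\ injective incl,
      continuous incl,
      injective (fun (w : W) (x : X) => inner w (incl x) : R)
    & exists K : R, forall (w : W) (x : X),
        `|inner w (incl x)| <= K * `|w| * `|x|].

(* X + X_h, as a subspace of W *)
Definition sum_with (incl : X -> W) (Xh : set W) : set W :=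
  [set incl v + vh | v in setT & vh in Xh].

End Spaces.

Section OptimalitySystems.
Context {R : realType} {X M W Q : hilbertType R}.

Definition continuous_optimality (incl : X -> W)
    (a : X -> X -> R) (b : X -> M -> R) (E : X -> Q) (f ud : W) (lambda : R)
    (Qad : set Q) (u : X) (p : M) (phi : X) (r : M) (y : Q) : Prop :=
  Qad y /\
  [/\ forall z, a u z + b z p = inner y (E z) + inner f (incl z),
      forall w, b u w = 0,
      forall z, a z phi - b z r = inner (incl u - ud) (incl z),
      forall w, b phi w = 0
    & forall x, Qad x -> 0 <= inner (E phi + lambda *: y) (x - y)].

Definition discrete_optimality (Xh : set W) (Mh : set M)
    (ah : W -> W -> R) (bh : W -> M -> R) (Eh : W -> Q) (f ud : W) (lambda : R)
    (Qadh : set Q) (uh : W) (ph : M) (phih : W) (rh : M) (yh : Q) : Prop :=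
  [/\ Xh uh, Mh ph, Xh phih, Mh rh & Qadh yh] /\
  [/\ forall zh, Xh zh ->
        ah uh zh + bh zh ph = inner yh (Eh zh) + inner f zh,
      forall wh, Mh wh -> bh uh wh = 0,
      forall zh, Xh zh -> ah zh phih - bh zh rh = inner (uh - ud) zh,
      forall wh, Mh wh -> bh phih wh = 0
    & forall xh, Qadh xh -> 0 <= inner (Eh phih + lambda *: yh) (xh - yh)].

(* (Pu, Rp) is the discrete state driven by the continuous control y. *)
Definition state_projection (Xh : set W) (Mh : set M)
    (ah : W -> W -> R) (bh : W -> M -> R) (Eh : W -> Q) (f : W)
    (y : Q) (Pu : W) (Rp : M) : Prop :=
  [/\ Xh Pu, Mh Rp,
      forall zh, Xh zh ->
        ah Pu zh + bh zh Rp = inner y (Eh zh) + inner f zh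
    & forall wh, Mh wh -> bh Pu wh = 0].

(* (Pphi, Rr) is the discrete adjoint state driven by the continuous state u. *)
Definition adjoint_projection (incl : X -> W) (Xh : set W) (Mh : set M)
    (ah : W -> W -> R) (bh : W -> M -> R) (ud : W)
    (u : X) (Pphi : W) (Rr : M) : Prop :=
  [/\ Xh Pphi, Mh Rr,
      forall zh, Xh zh -> ah zh Pphi - bh zh Rr = inner (incl u - ud) zh
    & forall wh, Mh wh -> bh Pphi wh = 0].

End OptimalitySystems.

(* Main.v *)
(* Test the continuous variational inequality with yh and the discrete one with
   Pi_h y and add them.  The cross term <Eh (Pphi - phih), y - yh> equals
   <u - uh, Pu - uh>, because the discrete state and adjoint equations for the
   differences Pu - uh and Pphi - phih may be tested with one another; this
   produces |u - uh|^2 with the right sign.  Discrete coercivity bounds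
   Pphi - phih by u - uh, and Young's inequality absorbs the rest. *)
Require Import Defs.
From HB Require Import structures.
From mathcomp Require Import all_boot all_order all_algebra.
From mathcomp Require Import all_classical all_reals all_analysis.
From mathcomp Require Import ring lra.

Set Implicit Arguments.
Unset Strict Implicit.
Unset Printing Implicit Defensive.

Import Order.TTheory GRing.Theory Num.Theory.
Import numFieldNormedType.Exports.

Local Open Scope classical_set_scope.
Local Open Scope ring_scope.

Section InnerProduct.
Context {R : realType} {H : hilbertType R}.
Implicit Types x y z : H.

Lemma innerC x y : inner x y = inner y x.
Proof. by rewrite hermC expr0 mul1r. Qed.

Lemma innerDl x y z : inner (x + y) z = inner x z + inner y z.
Proof. exact: linearDl. Qed.

Lemma innerBl x y z : inner (x - y) z = inner x z - inner y z.
Proof. exact: linearBl. Qed.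

Lemma innerZl c x z : inner (c *: x) z = c * inner x z.
Proof. exact: linearZl_LR. Qed.

Lemma innerBr x y z : inner z (x - y) = inner z x - inner z y.
Proof. exact: linearBr. Qed.

Lemma innerZr c x z : inner z (c *: x) = c * inner z x.
Proof. by rewrite innerC innerZl innerC. Qed.

(** Cauchy-Schwarz: the squared norm of [|y| x - |x| y] expands to
    [2 |x| |y| (|x| |y| - inner x y)]. Dividing by [|x| |y|] forces the zero vectors to be treated
    apart. *)
Lemma inner_le x y : inner x y <= `|x| * `|y|.
Proof.
have [->|x0] := eqVneq x 0.
  by rewrite normr0 mul0r -[X in inner X _](scale0r 0) innerZl mul0r.
have [->|y0] := eqVneq y 0.
  by rewrite normr0 mulr0 -[X in inner _ X](scale0r 0) innerZr mul0r.
have xy0 : 0 < `|x| * `|y| by rewrite mulr_gt0 ?normr_gt0.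
have : 0 <= inner (`|y| *: x - `|x| *: y) (`|y| *: x - `|x| *: y).
  by rewrite inner_norm sqr_ge0.
rewrite !(innerBl, innerBr, innerZl, innerZr) (innerC y x) !inner_norm => h.
by rewrite -(ler_pM2l xy0); lra.
Qed.

(** Here [g], [gP], [gh] stand for [E phi], [Eh Pphi], [Eh phih]. Orthogonality of [y - Py] enters
    twice: against [yh] it lets [y] replace [Py] in the [lambda] term, and against [Pg] it turns the
    leftover [inner g (Py - y)] into a product of two projection errors. *)
Lemma optimality_combined (lambda : R) (g gP gh Pg y yh Py : H) :
    0 <= inner (g + lambda *: y) (yh - y) ->
    0 <= inner (gh + lambda *: yh) (Py - yh) ->
    inner (y - Py) yh = 0 -> inner (y - Py) Pg = 0 ->
  lambda * `|y - yh| ^+ 2 + inner (gP - gh) (y - yh) <=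
    inner (gP - g) (y - yh) + inner (gP - gh) (y - Py)
    + inner (g - gP) (y - Py) + inner (g - Pg) (Py - y).
Proof.
rewrite -inner_norm !(innerBl, innerDl, innerBr, innerZl, innerZr).
by rewrite (innerC yh y) (innerC yh Py) (innerC Pg y) (innerC Pg Py); nra.
Qed.

End InnerProduct.

Section Subspaces.
Context {R : realType}.

Lemma fin_dim_subspaceB (V : lmodType R) (S : set V) v w :
  fin_dim_subspace S -> S v -> S w -> S (v - w).
Proof.
move=> [n [e ->]] [c _ <-] [d _ <-]; exists (c - d) => //.
by rewrite -sumrB; apply: eq_bigr => i _; rewrite !mxE scalerBl.
Qed.

Lemma linear_onB (V U : lmodType R) (D : set V) (f : V -> U) v w :
  linear_on D f -> D v -> D w -> f (v - w) = f v - f w.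
Proof.
by move=> fl Dv Dw; rewrite addrC -scaleN1r fl// scaleN1r addrC.
Qed.

End Subspaces.

Section DiscreteProblem.
Context {R : realType} {X M W Q : hilbertType R}.
Variables (incl : {linear X -> W}) (Xh : set W) (Mh : set M).
Variables (ah : W -> W -> R) (bh : W -> M -> R) (Eh : W -> Q) (f ud : W).
Hypothesis Xh_fin : fin_dim_subspace Xh.
Hypothesis ah_bil : bilinear_on Xh Xh ah.
Hypothesis bh_bil : bilinear_on Xh Mh bh.

Lemma null_spaceB v w :
  null_space Xh Mh bh v -> null_space Xh Mh bh w -> null_space Xh Mh bh (v - w).
Proof.
move=> [Xv bv] [Xw bw]; split; first exact: fin_dim_subspaceB.
by move=> m Mm; rewrite (linear_onB (bh_bil.1 m Mm))// bv// bw// subr0.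
Qed.

(** The discrete state equation is again a [state_projection], with datum [yh]. Subtracting cancels
    [f], and the pressures vanish against [z] in the discrete kernel. *)
Lemma state_difference y Pu Rp yh uh ph :
    state_projection Xh Mh ah bh Eh f y Pu Rp ->
    state_projection Xh Mh ah bh Eh f yh uh ph ->
  forall z, null_space Xh Mh bh z -> ah (Pu - uh) z = inner (y - yh) (Eh z).
Proof.
move=> [XPu MRp ePu bPu] [Xuh Mph euh buh] z [Xz bz].
rewrite (linear_onB (ah_bil.1 z Xz))// innerBl.
by move: (ePu z Xz) (euh z Xz); rewrite !bz//; lra.
Qed.

(* Not phrased with adjoint_projection, whose data is a u in X: the discrete
   adjoint state is driven by uh, which need not lie in X. *)
Lemma adjoint_difference (w wh : W) Pphi Rr phih rh :
    [/\ Xh Pphi, Mh Rr & forall z, Xh z ->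
        ah z Pphi - bh z Rr = inner (w - ud) z] ->
    [/\ Xh phih, Mh rh & forall z, Xh z ->
        ah z phih - bh z rh = inner (wh - ud) z] ->
  forall z, null_space Xh Mh bh z -> ah z (Pphi - phih) = inner (w - wh) z.
Proof.
move=> [XPphi MRr ePphi] [Xphih Mrh ephih] z [Xz bz].
rewrite (linear_onB (ah_bil.2 z Xz))//.
by move: (ePphi z Xz) (ephih z Xz); rewrite !bz// !innerBl; lra.
Qed.

End DiscreteProblem.

(** The unknown errors are [s] (control) and [t] (state). Young's inequality is weighted so that
    [D * s] costs half of [lambda * s ^+ 2] and the two products with [t] cost a quarter of [t ^+ 2]
    each, so half of the left side survives. *)
Lemma young_absorption (R : realFieldType) (lambda K s t A B D G : R) :
    0 < lambda ->
    lambda * s ^+ 2 + t ^+ 2 <= D * s + K * t * B + D * B + A * B + t * G ->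
  s ^+ 2 + t ^+ 2 <=
    (2 * lambda^-1 + 2) * (2^-1 * lambda^-1 + 1 + K ^+ 2)
    * (A ^+ 2 + B ^+ 2 + D ^+ 2 + G ^+ 2).
Proof.
move=> l0 h; set k := _ + K ^+ 2; set N := A ^+ 2 + _ + _ + _.
have li0 : 0 < lambda^-1 by rewrite invr_gt0.
have hDs : D * s <= lambda * s ^+ 2 / 2 + lambda^-1 * D ^+ 2 / 2.
  have : 0 <= lambda^-1 * (lambda * s - D) ^+ 2 by rewrite mulr_ge0 ?sqr_ge0 ?ltW.
  have -> : lambda^-1 * (lambda * s - D) ^+ 2 =
    lambda * s ^+ 2 - 2 * (D * s) + lambda^-1 * D ^+ 2 by field; rewrite gt_eqF.
  by lra.
have hKt : K * t * B <= t ^+ 2 / 4 + K ^+ 2 * B ^+ 2.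
  by have := sqr_ge0 (t / 2 - K * B); nra.
have hDB : D * B <= D ^+ 2 / 2 + B ^+ 2 / 2 by have := sqr_ge0 (D - B); nra.
have hAB : A * B <= A ^+ 2 / 2 + B ^+ 2 / 2 by have := sqr_ge0 (A - B); nra.
have htG : t * G <= t ^+ 2 / 4 + G ^+ 2 by have := sqr_ge0 (t / 2 - G); nra.
have hk : lambda^-1 * D ^+ 2 / 2 + K ^+ 2 * B ^+ 2 + D ^+ 2 / 2
    + A ^+ 2 / 2 + B ^+ 2 + G ^+ 2 <= k * N.
  have nn x y : 0 <= x -> 0 <= x * y ^+ 2 :> R.
    by move=> x0; rewrite mulr_ge0 ?sqr_ge0.
  have := (nn _ A (ltW li0), nn _ B (ltW li0), nn _ G (ltW li0)).
  have := (nn _ A (sqr_ge0 K), nn _ D (sqr_ge0 K), nn _ G (sqr_ge0 K)).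
  have := (sqr_ge0 A, sqr_ge0 D).
  by rewrite /k /N => -[? ?] [[? ?] ?] [[? ?] ?]; lra.
have hs : lambda * s ^+ 2 + t ^+ 2 <= 2 * (k * N) by lra.
(* Bounding [t ^+ 2] costs a factor 2 and bounding [s ^+ 2] a factor [2 * lambda^-1]; their sum is
   the first factor of the constant. *)
have ht : t ^+ 2 <= 2 * (k * N).
  by apply: le_trans hs; rewrite lerDr mulr_ge0 ?sqr_ge0 ?ltW.
have : lambda^-1 * (lambda * s ^+ 2) <= lambda^-1 * (2 * (k * N)).
  by rewrite ler_pM2l//; have := sqr_ge0 t; lra.
by rewrite mulKf ?gt_eqF//; lra.
Qed.

Theorem theorem2p3 (R : realType)
    (lambda C1 C2 alpha beta Cb1 Cb2 alphab Cb CW : R) :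
  0 < lambda -> 0 < alpha -> 0 < beta -> 0 < alphab -> 0 < Cb ->
  exists2 C : R, 0 < C &
  forall (X M W Q : hilbertType R)
    (* continuous setting *)
    (incl : {linear X -> W}) (E : {linear X -> Q}) (Qad : set Q) (f ud : W)
    (a : {bilinear X -> X -> R | *%R & *%R})
    (b : {bilinear X -> M -> R | *%R & *%R}),
  gelfand_inclusions incl ->
  continuous E ->
  Qad !=set0 -> closed Qad -> convex_set Qad ->
  (forall v z : X, `|a v z| <= C1 * `|v| * `|z|) ->
  (forall (z : X) (p : M), `|b z p| <= C2 * `|z| * `|p|) ->
  (forall v : X, null_space setT setT b v -> alpha * `|v| ^+ 2 <= a v v) ->
  (beta%:E <= inf_sup setT (fun z : X => `|z|%R) setT (fun p : M => `|p|%R) b)%E ->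
  (* discrete setting *)
  forall (Xh : set W) (Mh : set M) (Qh Qadh : set Q) (normh : W -> R)
    (ah : W -> W -> R) (bh : W -> M -> R) (Eh : W -> Q),
  fin_dim_subspace Xh -> fin_dim_subspace Mh -> fin_dim_subspace Qh ->
  norm_on (sum_with incl Xh) normh ->
  (forall v : X, normh (incl v) = `|v|) ->
  Qadh `<=` Qad -> Qadh `<=` Qh ->
  Qadh !=set0 -> closed Qadh -> convex_set Qadh ->
  bilinear_on Xh Xh ah -> bilinear_on Xh Mh bh ->
  (forall vh zh, Xh vh -> Xh zh ->
     `|ah vh zh| <= Cb1 * normh vh * normh zh) ->
  (forall zh ph, Xh zh -> Mh ph ->
     `|bh zh ph| <= Cb2 * normh zh * `|ph|) ->
  (forall vh, null_space Xh Mh bh vh -> alphab * normh vh ^+ 2 <= ah vh vh) ->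
  (Cb%:E <= inf_sup Xh normh Mh (fun p : M => `|p|%R) bh)%E ->
  linear_on (sum_with incl Xh) Eh ->
  (forall v : X, Eh (incl v) = E v) ->
  (* standing assumptions (I), (II), (III) *)
  (forall v, sum_with incl Xh v -> `|v| <= CW * normh v) ->
  (forall (v : X) vh, Xh vh ->
     `|Eh (incl v - vh)| <= normh (incl v - vh)) ->
  forall Pi_h : Q -> Q,
  orthogonal_projection Qh Pi_h ->
  (forall x, Qad x -> Qadh (Pi_h x)) ->
  (* solutions and projections *)
  forall (u phi : X) (p r : M) (y : Q) (uh phih : W) (ph rh : M) (yh : Q)
    (Pu Pphi : W) (Rp Rr : M),
  continuous_optimality incl a b E f ud lambda Qad u p phi r y ->
  discrete_optimality Xh Mh ah bh Eh f ud lambda Qadh uh ph phih rh yh ->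
  state_projection Xh Mh ah bh Eh f y Pu Rp ->
  adjoint_projection incl Xh Mh ah bh ud u Pphi Rr ->
  `|y - yh| ^+ 2 + `|incl u - uh| ^+ 2 <=
    C * (`|E phi - Pi_h (E phi)| ^+ 2 + `|y - Pi_h y| ^+ 2
         + normh (incl phi - Pphi) ^+ 2 + `|incl u - Pu| ^+ 2).
Proof.
(* [K] is the stability constant of the discrete adjoint problem; the absolute value makes it
   nonnegative whatever the sign of [CW]. *)
move=> l0 _ _ ab0 _; set K := `|CW| / alphab.
exists ((2 * lambda^-1 + 2) * (2^-1 * lambda^-1 + 1 + K ^+ 2)).
  have li0 : 0 < lambda^-1 by rewrite invr_gt0.
  by have K0 := sqr_ge0 K; rewrite mulr_gt0//; lra.
move=> X M W Q incl E Qad f ud a b _ _ _ _ _ _ _ _ _.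
move=> Xh Mh Qh Qadh normh ah bh Eh Xh_fin _ _ _ _ QadhS QadhQh _ _ _.
move=> ah_bil bh_bil _ _ ah_coer _ Eh_lin EhE W_le Eh_le Pi_h Pi_proj Pi_ad.
move=> u phi p r y uh phih ph rh yh Pu Pphi Rp Rr.
move=> [Qady [_ _ _ _ VI]] [[Xuh Mph Xphih Mrh Qadyh] [euh buh ephih bphih VIh]].
move=> sP [XPphi MRr ePphi bPphi].
have [XPu _ _ bPu] := sP.
have X0 : Xh 0 by rewrite -(subrr uh); exact: fin_dim_subspaceB.
have X_sum w : Xh w -> sum_with incl Xh w.
  by move=> Xw; exists 0 => //; exists w => //; rewrite linear0 add0r.
have i_sum v : sum_with incl Xh (incl v).
  by exists v => //; exists 0 => //; rewrite addr0.
have psi0 : null_space Xh Mh bh (Pphi - phih) by apply: null_spaceB.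
have d0 : null_space Xh Mh bh (Pu - uh) by apply: null_spaceB.
have Xpsi : Xh (Pphi - phih) by case: psi0.
have hadj := adjoint_difference ah_bil
  (And3 XPphi MRr ePphi) (And3 Xphih Mrh ephih).
(* Both sides equal [ah (Pu - uh) (Pphi - phih)]. *)
have cross : inner (Eh Pphi - Eh phih) (y - yh) = inner (incl u - uh) (Pu - uh).
  rewrite -hadj// (state_difference ah_bil sP (And4 Xuh Mph euh buh))//.
  by rewrite innerC -(linear_onB Eh_lin)//; exact: X_sum.
(* Assumption (II) at [v = 0] bounds [Eh] on [Xh] itself. *)
have Epsi : `|Eh Pphi - Eh phih| <= normh (Pphi - phih).
  rewrite -(linear_onB Eh_lin); [|exact: X_sum..].
  have := Eh_le 0 _ (fin_dim_subspaceB Xh_fin X0 Xpsi).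
  by rewrite linear0 !sub0r opprK.
have Ephi : `|E phi - Eh Pphi| <= normh (incl phi - Pphi).
  by rewrite -EhE -(linear_onB Eh_lin) ?Eh_le//; exact: X_sum.
(* Coercivity, the adjoint equation tested with [Pphi - phih] itself, and (I) bound
   [alphab * normh (Pphi - phih) ^+ 2] by [|CW| * normh (Pphi - phih)] times the state error; one
   factor [normh] is then cancelled. *)
have npsi : normh (Pphi - phih) <= K * `|incl u - uh|.
  have [n0|n0] := eqVneq (normh (Pphi - phih)) 0.
    by rewrite n0 mulr_ge0// divr_ge0// ltW.
  (* Nonnegativity is not a clause of [norm_on]; here it is read off [Epsi]. *)
  have np : 0 < normh (Pphi - phih).
    by rewrite lt_neqAle eq_sym n0 (le_trans _ Epsi).
  rewrite /K mulrAC ler_pdivlMr// mulrC -(ler_pM2r np) -mulrA -expr2.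
  apply: le_trans (ah_coer _ psi0) _; rewrite hadj//.
  apply: le_trans (inner_le _ _) _.
  rewrite (mulrC `|CW|) -mulrA ler_wpM2l//.
  apply: le_trans (W_le _ (X_sum _ Xpsi)) _.
  by rewrite ler_pM2r// ler_norm.
apply: young_absorption l0 _.
have [_ Pi_orth] := Pi_proj y.
have := optimality_combined (Eh Pphi) (VI _ (QadhS _ Qadyh))
  (VIh _ (Pi_ad _ Qady)) (Pi_orth _ (QadhQh _ Qadyh))
  (Pi_orth _ (Pi_proj (E phi)).1).
(* Writing [Pu - uh] as [(incl u - uh) - (incl u - Pu)] isolates the squared state error. *)
have -> : inner (Eh Pphi - Eh phih) (y - yh) =
    `|incl u - uh| ^+ 2 - inner (incl u - uh) (incl u - Pu).
  rewrite cross -inner_norm !innerBr; ring.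
(* [h1] to [h4] and the last Cauchy-Schwarz bound give, in order, the terms [D * s], [K * t * B],
   [D * B], [A * B] and [t * G] of [young_absorption]. *)
have h1 : inner (Eh Pphi - E phi) (y - yh) <=
    normh (incl phi - Pphi) * `|y - yh|.
  apply: le_trans (inner_le _ _) _.
  by rewrite ler_wpM2r// distrC.
have h2 : inner (Eh Pphi - Eh phih) (y - Pi_h y) <=
    K * `|incl u - uh| * `|y - Pi_h y|.
  apply: le_trans (inner_le _ _) _.
  by rewrite ler_wpM2r//; exact: le_trans Epsi npsi.
have h3 : inner (E phi - Eh Pphi) (y - Pi_h y) <=
    normh (incl phi - Pphi) * `|y - Pi_h y|.
  by apply: le_trans (inner_le _ _) _; rewrite ler_wpM2r.
have h4 : inner (E phi - Pi_h (E phi)) (Pi_h y - y) <=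
    `|E phi - Pi_h (E phi)| * `|y - Pi_h y|.
  by rewrite (distrC y) inner_le.
have := inner_le (incl u - uh) (incl u - Pu).
by lra.
Qed.
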